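(* Let $p\geq 2$ and $q\in\,]1,2]$ with $\frac1p+\frac1q=1$. Let $\mathcal{C}\subset\mathbb{R}^m$ be a centrally symmetric compact convex set with nonempty interior. The following assertions are equivalent: (a) (Set mid-convex property) There exists $\alpha>0$ such that for all $x,y\in\mathcal{C}$, $\frac{x+y}{2}+\alpha\|x-y\|_{\mathcal{C}}^p\,B_{\|\cdot\|_{\mathcal{C}}}(1)\subset\mathcal{C}$. (b) (Global scaling inequality) There exists $\alpha>0$ such that for all $x\in\mathcal{C}$, $y\in\partial\mathcal{C}$ and $d\in\mathbb{R}^m$ with $d\in N_{\mathcal{C}}(y)$ (equivalently $y\in\arg\max_{v\in\mathcal{C}}\langle d,v\rangle$), we have $\langle d, y-x\rangle\geq \alpha\|d\|_{\mathcal{C}^\circ}\|y-x\|_{\mathcal{C}}^p$. (c) (Set modulus UC) There exists $\alpha>0$ such that $\delta_{\|\cdot\|_{\mathcal{C}}}(\epsilon)\geq\alpha\epsilon^p$ for every $\epsilon\in[0,2]$. (d) (Support Hölder-smooth on the sphere) There exists $c>0$ such that $\sigma_{\mathcal{C}}$ is differentiable at every point of $S_{\|\cdot\|_{\mathcal{C}^\circ}}(1)$ and for all $d_1,d_2\in S_{\|\cdot\|_{\mathcal{C}^\circ}}(1)$, $\|\nabla\sigma_{\mathcal{C}}(d_1)-\nabla\sigma_{\mathcal{C}}(d_2)\|_{\mathcal{C}}\leq c\,\|d_1-d_2\|_{\mathcal{C}^\circ}^{q-1}=c\,\|d_1-d_2\|_{\mathcal{C}^\circ}^{1/(p-1)}$.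 (e) (Support US) $\sigma_{\mathcal{C}}^q$ is differentiable on $\mathbb{R}^m$ and there exists $c>0$ such that $\sigma_{\mathcal{C}}^q$ is $(c,q)$-uniformly smooth on $\mathbb{R}^m$ with respect to $\|\cdot\|_{\mathcal{C}^\circ}$, i.e. for all $d,d'\in\mathbb{R}^m$ and $\lambda\in[0,1]$, $\sigma_{\mathcal{C}}^q(\lambda d+(1-\lambda)d')+\frac{c}{q}\lambda(1-\lambda)\|d-d'\|_{\mathcal{C}^\circ}^q\geq\lambda\sigma_{\mathcal{C}}^q(d)+(1-\lambda)\sigma_{\mathcal{C}}^q(d')$. (f) (Gauge UC) There exists $\alpha>0$ such that $\|\cdot\|_{\mathcal{C}}^p$ is $(\alpha,p)$-uniformly convex with respect to $\|\cdot\|_{\mathcal{C}}$, i.e. for all $x,y\in\mathbb{R}^m$ and $\lambda\in[0,1]$, $\|\lambda x+(1-\lambda)y\|_{\mathcal{C}}^p+\frac{\alpha}{p}\lambda(1-\lambda)\|x-y\|_{\mathcal{C}}^p\leq\lambda\|x\|_{\mathcal{C}}^p+(1-\lambda)\|y\|_{\mathcal{C}}^p$.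
   Context: For a centrally symmetric compact convex body $\mathcal{C}\subset\mathbb{R}^m$ with nonempty interior, its gauge $\|x\|_{\mathcal{C}}=\inf\{\lambda\geq0: x\in\lambda\mathcal{C}\}$ is a norm whose unit ball is $\mathcal{C}$. The polar is $\mathcal{C}^\circ=\{d:\langle x,d\rangle\leq1\ \forall x\in\mathcal{C}\}$; the support function is $\sigma_{\mathcal{C}}(d)=\sup_{v\in\mathcal{C}}\langle v,d\rangle$, and $\sigma_{\mathcal{C}}=\|\cdot\|_{\mathcal{C}^\circ}$, which is the dual norm of $\|\cdot\|_{\mathcal{C}}$. For a norm $\|\cdot\|$, $B_{\|\cdot\|}(1)$ and $S_{\|\cdot\|}(1)$ denote its closed unit ball and unit sphere. The normal cone at $y\in\mathcal{C}$ is $N_{\mathcal{C}}(y)=\{d:\langle d,x-y\rangle\leq0\ \forall x\in\mathcal{C}\}$. The modulus of convexity of $\|\cdot\|_{\mathcal{C}}$ is, for $\epsilon\in[0,2]$, $\delta_{\|\cdot\|_{\mathcal{C}}}(\epsilon)=\inf\{1-\|(x+y)/2\|_{\mathcal{C}}: \|x\|_{\mathcal{C}}=\|y\|_{\mathcal{C}}=1,\ \|x-y\|_{\mathcal{C}}\geq\epsilon\}$. *)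

(* Defs.v *)
From HB Require Import structures.
From mathcomp Require Import all_boot all_order all_algebra.
From mathcomp Require Import all_classical all_reals all_analysis.
Set Implicit Arguments. Unset Strict Implicit. Unset Printing Implicit Defensive.
Import Order.TTheory GRing.Theory Num.Theory.
Import numFieldNormedType.Exports.
Local Open Scope classical_set_scope.
Local Open Scope ring_scope.

Section Defs.
Variables (R : realType) (m : nat).
Implicit Types (C : set 'rV[R]_m) (x y d : 'rV[R]_m).

Definition inner x y : R := \sum_(i < m) x 0 i * y 0 i.

Definition gauge C x : R :=
  inf [set l : R | 0 <= l /\ exists c, C c /\ x = l *: c].

Definition convex_set C : Prop :=
  forall x y (l : R), C x -> C y -> 0 <= l <= 1 -> C (l *: x + (1 - l) *: y).
Definition centrally_symmetric C : Prop := forall x, C x -> C (- x).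

Definition sym_convex_body C : Prop :=
  [/\ compact C, convex_set C, centrally_symmetric C & exists x, (interior C) x].

Definition polar C : set 'rV[R]_m := [set d | forall x, C x -> inner x d <= 1].

Definition supp_fn C d : R := sup [set inner v d | v in C].

Definition boundary C : set 'rV[R]_m := closure C `\` interior C.

Definition normal_cone C y : set 'rV[R]_m :=
  [set d | forall x, C x -> inner d (x - y) <= 0].

(* modulus of convexity of ||.||_C (extended-real infimum, inf set0 = +oo) *)
Definition modulus_convexity C (e : R) : \bar R :=
  ereal_inf [set r : \bar R | exists x y, [/\ gauge C x = 1, gauge C y = 1,
     e <= gauge C (x - y) & r = (1 - gauge C ((1/2 : R) *: (x + y)))%:E] ].

Definition grad (f : 'rV[R]_m -> R) x : 'rV[R]_m :=
  \row_(i < m) ('d f x (delta_mx 0 i : 'rV[R]_m)).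

End Defs.

(* Main.v *)
Require Import Defs.
From HB Require Import structures.
From mathcomp Require Import all_boot all_order all_algebra.
From mathcomp Require Import all_classical all_reals all_analysis.
From mathcomp Require Import lra ring.
Import Order.TTheory GRing.Theory Num.Theory.
Import numFieldNormedType.Exports.
Local Open Scope classical_set_scope.
Local Open Scope ring_scope.

(* Write S for the support function (the dual norm of the gauge N).  Everything is
   read off the maximizers x(d) of <., d> over C.  The scaling inequality at d1
   bounds N (x(d1) - x(d2)) by a multiple of (S (d1 - d2) / S d1)^(q-1).  Hence
   x(d) is the gradient of S, and S(d)^(q-1) x(d), which is 1/q times the gradient
   of S^q, is globally (q-1)-Hoelder; this gives (b) => (d) and (b) => (e).
   Conjugate duality between S^q/q and N^p/p gives (e) => (f).  For (d) => (c) one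
   tests 2 N((x+y)/2) + <x-y, h> <= S(d+h) + S(d-h) <= 2 + K S(h)^q with h of size
   proportional to N(x-y)^(p-1).  The cycles a => b => e => f => a and
   b => d => c => b cover all the equivalences. *)

(** * Real powers with conjugate exponents *)

Section Powers.
Context {R : realType}.
Implicit Types (a k l n p q r s t u : R).

Lemma powR_le r s t : 0 <= r -> 0 <= s -> s <= t -> s `^ r <= t `^ r.
Proof.
move=> r0 s0 st; apply: ge0_ler_powR => //; rewrite nnegrE //.
exact: le_trans st.
Qed.

(** The fractions [s / (s + t)] and [t / (s + t)] sum to 1, and each is at most its [r]-th power
    because [r <= 1]. *)
Lemma powR_subadditive r s t :
  0 < r -> r <= 1 -> 0 <= s -> 0 <= t -> (s + t) `^ r <= s `^ r + t `^ r.
Proof.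
move=> r0 r1 s0 t0.
have [st0|st0] := eqVneq (s + t) 0.
  by rewrite st0 powR0 ?gt_eqF// addr_ge0 ?powR_ge0.
have stp : 0 < s + t by rewrite lt_neqAle eq_sym st0 addr_ge0.
have frac v : 0 <= v -> v <= s + t -> v / (s + t) * (s + t) `^ r <= v `^ r.
  move=> v0 vst; have [->|vn0] := eqVneq v 0; first by rewrite !mul0r powR_ge0.
  have vp : 0 < v by rewrite lt_neqAle eq_sym vn0.
  rewrite -[in leRHS](divfK st0 v) powRM ?divr_ge0 ?(ltW stp)//.
  rewrite ler_wpM2r ?powR_ge0// ger1_powR// divr_gt0//=.
  by rewrite ler_pdivrMr// mul1r.
rewrite -[leLHS]mul1r -(divff st0) mulrDl mulrDl.
by apply: lerD; apply: frac; rewrite // ?lerDl ?lerDr.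
Qed.

Lemma powR_dist r s t :
  0 < r -> r <= 1 -> 0 <= s -> 0 <= t -> `|s `^ r - t `^ r| <= `|s - t| `^ r.
Proof.
move=> r0 r1; wlog st : s t / t <= s => [hw s0 t0|s0 t0].
  have [/hw->//|/ltW ts] := leP t s.
  by rewrite distrC [`|s - t|]distrC hw.
rewrite ger0_norm ?subr_ge0 ?powR_le ?(ltW r0)// ger0_norm ?subr_ge0//.
by rewrite lerBlDl -{1}(subrKC t s) powR_subadditive ?subr_ge0.
Qed.

Context {p q : R} (p1 : 1 < p) (q1 : 1 < q) (pq : p^-1 + q^-1 = 1).

Lemma conjM1 : (p - 1) * (q - 1) = 1.
Proof.
have p0 : p != 0 by rewrite gt_eqF// (lt_trans _ p1).
have q0 : q != 0 by rewrite gt_eqF// (lt_trans _ q1).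
have : (p^-1 + q^-1) * (p * q) = p * q by rewrite pq mul1r.
rewrite mulrDl mulrA mulVf// mul1r mulrCA mulVf// mulr1 => e.
by rewrite mulrBl mul1r mulrBr mulr1 -e; ring.
Qed.

Lemma conj_powR t : (t `^ (p - 1)) `^ q = t `^ p.
Proof.
rewrite -powRrM; congr powR.
by have := conjM1; rewrite mulrBl mul1r mulrBr mulr1 => e; rewrite mulrBl mul1r; lra.
Qed.

Lemma powR_young s t : 0 <= s -> 0 <= t -> s * t <= s `^ p / p + t `^ q / q.
Proof. by move=> s0 t0; apply: conjugate_powR => //; exact: lt_trans _ (_ : 1 < _). Qed.

(** Young's inequality for [s] and [t^(p-1)], whose equality case is [s = t]; no derivative of the
    power is taken. *)
Lemma powR_tangent s t : 0 <= s -> 0 <= t ->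
  t `^ p + p * t `^ (p - 1) * (s - t) <= s `^ p.
Proof.
move=> s0 t0; have p0 : 0 < p := lt_trans ltr01 p1.
have := powR_young s (t `^ (p - 1)) s0 (powR_ge0 _ _).
rewrite conj_powR -(ler_pM2l p0) mulrDr [p * (s `^ p / p)]mulrC divfK ?gt_eqF//.
have -> : p * (t `^ p / q) = (p - 1) * t `^ p.
  have -> : q^-1 = 1 - p^-1 by rewrite -pq addrAC subrr add0r.
  by field; rewrite gt_eqF.
have := mulr_powRB1 t0 p0; move: (t `^ (p - 1)) (t `^ p) (s `^ p).
by move=> x y z <- h; nra.
Qed.

(** The tangent inequalities at [u] are averaged with weights [l] and [1 - l]; the linear terms
    cancel. *)
Lemma powR_convex l s t : 0 <= l <= 1 -> 0 <= s -> 0 <= t ->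
  (l * s + (1 - l) * t) `^ p <= l * s `^ p + (1 - l) * t `^ p.
Proof.
move=> /andP[l0 l1] s0 t0; set u := l * s + (1 - l) * t.
have l1' : 0 <= 1 - l by lra.
have u0 : 0 <= u by rewrite addr_ge0 ?mulr_ge0.
have hs := ler_wpM2l l0 (powR_tangent s u s0 u0).
have ht := ler_wpM2l l1' (powR_tangent t u t0 u0).
apply: le_trans (lerD hs ht); rewrite le_eqVlt; apply/orP; left; apply/eqP.
by rewrite /u; ring.
Qed.

Lemma powR_le_root s t : 0 <= s -> 0 <= t -> s `^ (p - 1) <= t -> s <= t `^ (q - 1).
Proof.
move=> s0 t0 st.
have -> : s = (s `^ (p - 1)) `^ (q - 1) by rewrite -powRrM conjM1 powRr1.
by apply: powR_le; rewrite ?powR_ge0// subr_ge0 (ltW q1).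
Qed.

Lemma le_powR_conj a s t : 0 < a -> 0 <= s -> 0 <= t ->
  a * s `^ p <= t * s -> s <= (t / a) `^ (q - 1).
Proof.
move=> a0; rewrite le_eqVlt => /predU1P[<- _ _|s0 t0]; first by rewrite powR_ge0.
rewrite -(mulr_powRB1 (ltW s0) (lt_trans ltr01 p1)) mulrCA mulrC ler_pM2r// => h.
by apply: powR_le_root; rewrite ?(ltW s0) ?divr_ge0 ?(ltW a0)// ler_pdivlMr// mulrC.
Qed.

(** As [q > 1], the term [K * k^q] is negligible against [k] for small [k]. This sizes the
    perturbations in the duality arguments, where a loss of order [k^q] must stay below half of a
    gain linear in [k]. *)
Lemma small_multiplier K k0 : 0 <= K -> 0 < k0 ->
  exists k, [/\ 0 < k, k <= k0 & K * k `^ q <= k / 2].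
Proof.
(* The summand 1 keeps the denominator positive when [K = 0]; [k^(q-1) <= e] will give
   [K * k^(q-1) <= 1/2]. *)
move=> K0 k00; pose e := (2 * (K + 1))^-1; have e0 : 0 < e by rewrite invr_gt0; lra.
exists (Num.min k0 (e `^ (p - 1))); set k := Num.min _ _.
have kgt0 : 0 < k by rewrite lt_min k00 powR_gt0.
split => //; first by rewrite ge_min lexx.
rewrite -(mulr_powRB1 (ltW kgt0) (lt_trans ltr01 q1)) mulrCA ler_pM2l//.
have : k `^ (q - 1) <= e.
  apply: (@le_trans _ _ ((e `^ (p - 1)) `^ (q - 1))).
    by apply: powR_le; rewrite ?(ltW kgt0) ?subr_ge0 ?(ltW q1)// ge_min lexx orbT.
  by rewrite -powRrM conjM1 powRr1// (ltW e0).
move=> /(ler_wpM2l K0) /le_trans; apply.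
by rewrite /e invfM mulrCA -[leRHS]mulr1 ler_pM2l ?invr_gt0// ler_pdivrMr ?mul1r; lra.
Qed.

End Powers.

(** * Inner product *)

Section Inner.
Context {R : realType} {m : nat}.
Implicit Types (x y z d : 'rV[R]_m) (l : R).

Lemma innerC x y : inner x y = inner y x.
Proof. by apply: eq_bigr => i _; rewrite mulrC. Qed.

Lemma inner_linear x : linear (inner x).
Proof.
move=> l y z; rewrite /inner scaler_sumr -big_split; apply: eq_bigr => i _ /=.
by rewrite !mxE mulrDr; congr (_ + _); rewrite mulrCA.
Qed.

(** With this structure [inner x] can serve as a candidate differential. *)
HB.instance Definition _ x :=
  GRing.isLinear.Build R 'rV[R]_m R _ (inner x) (inner_linear x).

Lemma innerDr x y z : inner x (y + z) = inner x y + inner x z.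
Proof. exact: linearD. Qed.
Lemma innerNr x y : inner x (- y) = - inner x y.
Proof. exact: linearN. Qed.
Lemma innerBr x y z : inner x (y - z) = inner x y - inner x z.
Proof. exact: linearB. Qed.
Lemma innerZr x l y : inner x (l *: y) = l * inner x y.
Proof. exact: linearZ. Qed.
Lemma inner0r x : inner x 0 = 0.
Proof. exact: linear0. Qed.
Lemma innerDl x y z : inner (y + z) x = inner y x + inner z x.
Proof. by rewrite innerC innerDr !(innerC x). Qed.
Lemma innerNl x y : inner (- y) x = - inner y x.
Proof. by rewrite innerC innerNr innerC. Qed.
Lemma innerBl x y z : inner (y - z) x = inner y x - inner z x.
Proof. by rewrite innerDl innerNl. Qed.
Lemma innerZl x l y : inner (l *: y) x = l * inner y x.
Proof. by rewrite innerC innerZr innerC. Qed.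
Lemma inner0l x : inner 0 x = 0.
Proof. by rewrite innerC inner0r. Qed.

Lemma inner_ge0 x : 0 <= inner x x.
Proof. by apply: sumr_ge0 => i _; exact: sqr_ge0. Qed.

Lemma inner_gt0 x : (0 < inner x x) = (x != 0).
Proof.
rewrite lt_neqAle inner_ge0 andbT eq_sym; congr negb; apply/eqP/eqP => [|->].
  move/psumr_eq0P => h; apply/rowP => i; rewrite mxE; apply/eqP.
  by rewrite -sqrf_eq0 expr2 h// => j _; exact: sqr_ge0.
by rewrite inner0r.
Qed.

Lemma inner_delta x i : inner x (delta_mx 0 i) = x 0 i.
Proof.
rewrite /inner (bigD1 i)//= mxE !eqxx mulr1 big1 ?addr0// => j ji.
by rewrite mxE (negbTE ji) andbF mulr0.
Qed.

Lemma continuous_inner (T : topologicalType) (f g : T -> 'rV[R]_m) :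
  continuous f -> continuous g -> continuous (fun t => inner (f t) (g t)).
Proof.
move=> cf cg; apply: continuous_big => [|i _ t]; first exact: add_continuous.
have coord (h : T -> 'rV[R]_m) : continuous h -> (h u 0 i : R) @[u --> t] --> h t 0 i.
  move=> ch; apply: (@continuous_comp _ _ _ h (fun y : 'rV[R]_m => y 0 i)).
    exact: ch.
  exact: coord_continuous.
by apply: cvgM; exact: coord.
Qed.

Lemma inner_continuous x : continuous (inner x).
Proof.
by apply: (continuous_inner _ (cst x) id) => y; [exact: cst_continuous|exact: cvg_id].
Qed.

Lemma coord_le_norm x i : `|x 0 i| <= `|x|.
Proof. by rewrite [leRHS]/Num.norm /= mx_normrE (le_bigmax _ _ (0, i)). Qed.

Lemma norm_row_le x l : 0 <= l -> (forall i, `|x 0 i| <= l) -> `|x| <= l.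
Proof.
move=> l0 h; rewrite [leLHS]/Num.norm /= mx_normrE; apply: bigmax_le => // -[i j] _ /=.
by rewrite ord1.
Qed.

(** The norm on row vectors is the maximum norm, whence the factor [m]. *)
Lemma norm_inner x y : `|inner x y| <= m%:R * `|x| * `|y|.
Proof.
apply: le_trans (ler_norm_sum _ _ _) _.
rewrite -mulrA mulr_natl -[leRHS]iter_addr_0 -[leRHS]big_const_ord; apply: ler_sum => i _.
by rewrite normrM ler_pM// coord_le_norm.
Qed.

End Inner.

(** * Gauge and support function of a symmetric convex body *)

Section Body.
Context {R : realType} {m : nat} {C : set 'rV[R]_m} (hC : sym_convex_body C).
Implicit Types (x y z v d u : 'rV[R]_m) (l : R).

Lemma body_closed : closed C.
Proof. by case: hC => cC _ _ _; apply: compact_closed => //; exact: norm_hausdorff. Qed.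

Lemma bodyN x : C x -> C (- x).
Proof. by case: hC => _ _ sC _; exact: sC. Qed.

Lemma body_convex x y l : C x -> C y -> 0 <= l <= 1 -> C (l *: x + (1 - l) *: y).
Proof. by case: hC => _ cC _ _; exact: cC. Qed.

Lemma body0 : C 0.
Proof.
have [_ _ _ [x /interior_subset Cx]] := hC.
have := body_convex x (- x) 2^-1 Cx (bodyN x Cx).
rewrite scalerN -scalerBl (_ : 2^-1 - _ = 0) ?scale0r; last by lra.
by apply; lra.
Qed.

Lemma bodyZ x l : C x -> `|l| <= 1 -> C (l *: x).
Proof.
move=> Cx l1; have pos k : 0 <= k <= 1 -> C (k *: x).
  by move=> k1; have := body_convex x 0 k Cx body0 k1; rewrite scaler0 addr0.
have [l0|l0] := leP 0 l; first by apply: pos; rewrite l0 -(ger0_norm l0).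
rewrite -[l]opprK scaleNr; apply/bodyN/pos.
by rewrite -(ltr0_norm l0) normr_ge0.
Qed.

(** If a ball around [x0] lies in [C], then for small [x] both [x0 + 2 *: x] and [- x0] lie in [C],
    and [x] is their midpoint. *)
Lemma body_ball : exists2 r : R, 0 < r & forall x, `|x| <= r -> C x.
Proof.
have [_ _ _ [x0 Cx0]] := hC.
have /nbhs_ballP[e /= e0 eC] := Cx0.
have Cx0' := interior_subset Cx0.
exists (e / 4) => [|x xe]; first by rewrite divr_gt0.
have C1 : C (x0 + 2 *: x).
  apply: eC; rewrite -ball_normE /= opprD addNKr normrN normrZ ger0_norm//; lra.
have := body_convex _ _ 2^-1 C1 (bodyN _ Cx0').
rewrite scalerDr scalerA scalerN mulVf// scale1r (_ : 1 - 2^-1 = 2^-1); last by lra.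
by rewrite addrAC subrr add0r; apply; lra.
Qed.

Lemma body_bounded : exists2 M : R, 0 < M & forall x, C x -> `|x| <= M.
Proof.
have [cC _ _ _] := hC; have [M [Mr hM]] := compact_bounded cC.
exists (`|M| + 1) => [|x Cx]; first by rewrite ltr_wpDl.
by apply: hM => //; rewrite (le_lt_trans (ler_norm _))// ltrDl.
Qed.

(** * The gauge as a norm with unit ball [C] *)

Let gset x := [set l : R | 0 <= l /\ exists c, C c /\ x = l *: c].

Let gset_lb x : has_lbound (gset x).
Proof. by exists 0 => l []. Qed.

Let gset_norm r x : 0 < r -> (forall z, `|z| <= r -> C z) -> x != 0 ->
  gset x (`|x| / r).
Proof.
move=> r0 rC x0; have nx : 0 < `|x| by rewrite normr_gt0.
split; first by rewrite divr_ge0// ltW.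
exists ((`|x| / r)^-1 *: x); rewrite scalerA divff ?scale1r ?mulf_neq0 ?gt_eqF ?invr_gt0//.
split=> //; apply: rC; rewrite normrZ invf_div normrM normfV normr_id (gtr0_norm r0).
by rewrite divfK// gt_eqF.
Qed.

Let gset_nonempty x : gset x !=set0.
Proof.
have [->|x0] := eqVneq x 0.
  by exists 0; split => //; exists 0; split; [exact: body0|rewrite scaler0].
by have [r r0 rC] := body_ball; exists (`|x| / r); exact: gset_norm.
Qed.

Lemma gauge_le l x : 0 <= l -> C x -> gauge C (l *: x) <= l.
Proof. by move=> l0 Cx; apply: (ge_inf (gset_lb _)); split=> //; exists x. Qed.

Lemma gauge_ge0 x : 0 <= gauge C x.
Proof. by apply: (lb_le_inf (gset_nonempty x)) => l []. Qed.

Lemma gauge0 : gauge C 0 = 0.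
Proof.
apply/le_anti; rewrite gauge_ge0 andbT.
by rewrite -(scale0r (0 : 'rV[R]_m)); apply: gauge_le => //; exact: body0.
Qed.

Let gset_adherent x e : 0 < e -> exists2 l, gset x l & gauge C x <= l < gauge C x + e.
Proof.
move=> e0; have [|l gl le] := @inf_adherent _ (gset x) e e0; first by split.
by exists l => //; rewrite le andbT; exact: (ge_inf (gset_lb _)).
Qed.

(** The infimum is attained. If it is 0, boundedness of [C] forces [x = 0]; otherwise [x] divided by
    its gauge is a limit of points [c] of the closed set [C]. *)
Lemma gaugeP x : exists2 c, C c & x = gauge C x *: c.
Proof.
have [M M0 CM] := body_bounded.
have [g0|gn0] := eqVneq (gauge C x) 0.
  exists 0; [exact: body0|rewrite g0 scale0r; apply/eqP].
  rewrite -normr_le0; apply/ler_addgt0Pl => e e0; rewrite addr0.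
  have [|l [l0 [c [Cc xE]]] /andP[_]] := gset_adherent x (e / M).
    by rewrite divr_gt0.
  rewrite g0 add0r ltr_pdivlMr// => lM; rewrite xE normrZ ger0_norm//.
  by apply: le_trans (ltW lM); rewrite ler_wpM2l// CM.
have gp : 0 < gauge C x by rewrite lt_neqAle eq_sym gn0 gauge_ge0.
exists ((gauge C x)^-1 *: x); last by rewrite scalerA divff// scale1r.
apply: body_closed => B /nbhs_ballP[e /= e0 eB].
(* The tolerance on [l] that places [c] within [e] of the rescaled [x], since [c] has norm at most
   [M]. *)
have dp : 0 < e * gauge C x / M by rewrite divr_gt0// mulr_gt0.
have [l [l0 [c [Cc xE]]] /andP[gl lg]] := gset_adherent x _ dp.
exists c; split=> //; apply: eB; rewrite -ball_normE /=.
rewrite {2}xE scalerA -[X in _ - X]scale1r -scalerBl normrZ.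
have -> : (gauge C x)^-1 * l - 1 = (l - gauge C x) / gauge C x by field.
rewrite ger0_norm ?divr_ge0 ?subr_ge0 ?(ltW gp)//.
apply: (@le_lt_trans _ _ ((l - gauge C x) / gauge C x * M)).
  by rewrite ler_wpM2l ?CM// divr_ge0 ?subr_ge0 ?(ltW gp).
by rewrite -ltr_pdivlMr// ltr_pdivrMr// mulrAC ltrBlDl.
Qed.

Lemma gauge_le1 x : gauge C x <= 1 <-> C x.
Proof.
split=> [g1|Cx]; last by rewrite -[x]scale1r; exact: gauge_le.
have [c Cc ->] := gaugeP x; apply: bodyZ => //.
by rewrite ger0_norm// gauge_ge0.
Qed.

Lemma gauge_eq0 x : gauge C x = 0 -> x = 0.
Proof. by have [c _ {2}->] := gaugeP x => ->; rewrite scale0r. Qed.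

Lemma gauge_gt0 x : x != 0 -> 0 < gauge C x.
Proof.
by move=> x0; rewrite lt_neqAle gauge_ge0 andbT eq_sym; apply: contra_neq x0 => /gauge_eq0.
Qed.

(** Divided by [s], the sum [x + y] is the convex combination of [c] and [b] with weights
    [gauge C x / s] and [gauge C y / s]. *)
Lemma gaugeD x y : gauge C (x + y) <= gauge C x + gauge C y.
Proof.
have [c Cc xE] := gaugeP x; have [b Cb yE] := gaugeP y.
have x0 := gauge_ge0 x; have y0 := gauge_ge0 y.
have [s0|sn0] := eqVneq (gauge C x + gauge C y) 0.
  move/eqP: s0; rewrite paddr_eq0// => /andP[/eqP/gauge_eq0-> /eqP/gauge_eq0->].
  by rewrite addr0 gauge0 addr0.
set s := gauge C x + gauge C y in sn0 *.
have sp : 0 < s by rewrite lt_neqAle eq_sym sn0 addr_ge0.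
have -> : x + y = s *: ((gauge C x / s) *: c + (1 - gauge C x / s) *: b).
  rewrite scalerDr !scalerA mulrBr mulr1 mulrCA divff// mulr1 -xE.
  by rewrite (_ : s - _ = gauge C y) -?yE// /s addrAC subrr add0r.
apply: gauge_le; first exact: ltW.
apply: body_convex => //; rewrite divr_ge0 ?(ltW sp)//= ler_pdivrMr// mul1r.
by rewrite /s lerDl.
Qed.

(** One inequality suffices: applied to the factor [l^-1] and the vector [l *: x], it yields the
    reverse one. *)
Lemma gaugeZ l x : gauge C (l *: x) = `|l| * gauge C x.
Proof.
have le k y : gauge C (k *: y) <= `|k| * gauge C y.
  have [c Cc yE] := gaugeP y.
  have -> : k *: y = (`|k| * gauge C y) *: (Num.sg k *: c).
    by rewrite {1}yE !scalerA -{1}[k]mulr_sg_norm; congr (_ *: _); ring.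
  apply: gauge_le; first by rewrite mulr_ge0// gauge_ge0.
  by apply: bodyZ => //; rewrite normr_sg lern1 leq_b1.
apply/le_anti; rewrite le /=.
have [->|l0] := eqVneq l 0; first by rewrite normr0 mul0r gauge_ge0.
have := le l^-1 (l *: x); rewrite scalerA mulVf// scale1r normfV.
by rewrite ler_pdivlMl// normr_gt0.
Qed.

Lemma gaugeN x : gauge C (- x) = gauge C x.
Proof. by rewrite -scaleN1r gaugeZ normrN1 mul1r. Qed.

Lemma gaugeBC x y : gauge C (x - y) = gauge C (y - x).
Proof. by rewrite -gaugeN opprB. Qed.

Lemma gauge_norm : exists2 K : R, 0 < K & forall x, gauge C x <= K * `|x|.
Proof.
have [r r0 rC] := body_ball; exists r^-1 => [|x]; first by rewrite invr_gt0.
have [->|x0] := eqVneq x 0; first by rewrite gauge0 normr0 mulr0.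
by rewrite mulrC; apply: (ge_inf (gset_lb _)); exact: gset_norm.
Qed.

(** * The support function as the dual norm *)

Lemma supp_fnP d : exists2 v, C v & inner v d = supp_fn C d.
Proof.
have [cC _ _ _] := hC.
have [||c /[!inE] Cc cmax] := EVT_max_rV _ cC _ (f := inner d).
- by exists 0; exact: body0.
- exact/continuous_subspaceT/inner_continuous.
exists c => //; apply/le_anti/andP; split.
  apply: ub_le_sup; last by exists c.
  by exists (inner d c) => _ [v Cv <-]; rewrite innerC cmax// inE.
apply: ge_sup; first by exists (inner c d); exists c.
by move=> _ [v Cv <-]; rewrite innerC [leRHS]innerC cmax// inE.
Qed.

Lemma supp_fn_ge d v : C v -> inner v d <= supp_fn C d.
Proof.
move=> Cv; apply: ub_le_sup; last by exists v.
have [M M0 CM] := body_bounded.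
exists (m%:R * M * `|d|) => _ [w Cw <-].
apply: le_trans (ler_norm _) _; apply: le_trans (norm_inner _ _) _.
by rewrite ler_wpM2r// ler_wpM2l// CM.
Qed.

Lemma inner_le x d : inner x d <= gauge C x * supp_fn C d.
Proof.
have [c Cc {1}->] := gaugeP x.
by rewrite innerZl ler_wpM2l ?gauge_ge0// supp_fn_ge.
Qed.

Lemma supp_fn_ge0 d : 0 <= supp_fn C d.
Proof. by have := supp_fn_ge d 0 body0; rewrite inner0l. Qed.

Lemma supp_fn0 : supp_fn C 0 = 0.
Proof. by have [v _ <-] := supp_fnP 0; rewrite inner0r. Qed.

Lemma supp_fnD d u : supp_fn C (d + u) <= supp_fn C d + supp_fn C u.
Proof. by have [v Cv <-] := supp_fnP (d + u); rewrite innerDr lerD// supp_fn_ge. Qed.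

Lemma supp_fnZ l d : supp_fn C (l *: d) = `|l| * supp_fn C d.
Proof.
have le k b : supp_fn C (k *: b) <= `|k| * supp_fn C b.
  have [v Cv <-] := supp_fnP (k *: b).
  rewrite innerZr -{1}[k]mulr_sg_norm mulrAC mulrC ler_wpM2l// -innerZl.
  by apply/supp_fn_ge/bodyZ => //; rewrite normr_sg lern1 leq_b1.
apply/le_anti; rewrite le /=.
have [->|l0] := eqVneq l 0; first by rewrite normr0 mul0r supp_fn_ge0.
have := le l^-1 (l *: d); rewrite scalerA mulVf// scale1r normfV.
by rewrite ler_pdivlMl// normr_gt0.
Qed.

Lemma supp_fnN d : supp_fn C (- d) = supp_fn C d.
Proof. by rewrite -scaleN1r supp_fnZ normrN1 mul1r. Qed.

Lemma supp_fnBC d u : supp_fn C (d - u) = supp_fn C (u - d).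
Proof. by rewrite -supp_fnN opprB. Qed.

Lemma supp_fn_gt0 d : d != 0 -> 0 < supp_fn C d.
Proof.
rewrite -inner_gt0 => d0; have := inner_le d d.
rewrite ltNge; apply: contraTN => s0; rewrite -ltNge (le_lt_trans _ d0)//.
by rewrite mulr_ge0_le0// gauge_ge0.
Qed.

Lemma supp_fn_norm : exists2 K : R, 0 < K & forall d, supp_fn C d <= K * `|d|.
Proof.
have [M M0 CM] := body_bounded; exists (m%:R * M + 1) => [|d].
  by rewrite ltr_wpDl// mulr_ge0// ltW.
have [v Cv <-] := supp_fnP d; apply: le_trans (ler_norm _) _.
apply: le_trans (norm_inner _ _) _; rewrite ler_wpM2r//.
by rewrite ler_wpDr// ler_wpM2l// CM.
Qed.

(** * The polar, separation and bipolar duality *)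

Lemma polarE : polar C = [set d | supp_fn C d <= 1].
Proof.
apply/seteqP; split=> d /=; first by move=> dC; have [v Cv <-] := supp_fnP d; exact: dC.
by move=> d1 x Cx; exact: le_trans (supp_fn_ge d x Cx) d1.
Qed.

(** The value [supp_fn C d] is the least element of the set whose infimum is the gauge of the
    polar. *)
Lemma gauge_polar d : gauge (polar C) d = supp_fn C d.
Proof.
have lb : lbound [set l : R | 0 <= l /\ exists c, polar C c /\ d = l *: c] (supp_fn C d).
  move=> l [l0 [c []]]; rewrite polarE /= => c1 ->.
  by rewrite supp_fnZ ger0_norm// ler_piMr.
have mem : [set l : R | 0 <= l /\ exists c, polar C c /\ d = l *: c] (supp_fn C d).
  split; first exact: supp_fn_ge0.
  rewrite polarE; have [->|d0] := eqVneq d 0.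
    by exists 0; rewrite scaler0 /= supp_fn0.
  have s0 := supp_fn_gt0 d d0.
  exists ((supp_fn C d)^-1 *: d); rewrite scalerA divff ?gt_eqF// scale1r; split => //=.
  by rewrite supp_fnZ normfV gtr0_norm// mulVf// gt_eqF.
apply/le_anti/andP; split; first by apply: ge_inf => //; exists (supp_fn C d).
by apply: lb_le_inf => //; exists (supp_fn C d).
Qed.

(** The polar is an intersection of closed half-spaces, and testing [d] against the signed basis
    vectors, whose gauge is at most [K], bounds its coordinates. *)
Lemma polar_compact : compact (polar C).
Proof.
apply: bounded_closed_compact.
  have [K K0 gK] := gauge_norm.
  exists K; split; first by rewrite num_real.
  move=> M KM d; rewrite polarE /= => d1; apply: norm_row_le => [|i].
    exact: le_trans (ltW K0) (ltW KM).
  have g e : `|e| <= 1 -> inner d e <= M.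
    move=> e1; rewrite innerC; apply: le_trans (inner_le _ _) _.
    apply: le_trans (ltW KM); apply: le_trans (_ : gauge C e * 1 <= _).
      by rewrite ler_wpM2l// gauge_ge0.
    by rewrite mulr1; apply: le_trans (gK e) _; rewrite ler_piMr// ltW.
  have e1 : `|delta_mx 0 i : 'rV[R]_m| <= 1.
    by apply: norm_row_le => // j; rewrite mxE eqxx /= ; case: eqP => _; rewrite ?normr1 ?normr0.
  rewrite -inner_delta ler_norml g// andbT lerNl -innerNr.
  by apply: g; rewrite normrN.
have -> : polar C = \bigcap_(x in C) [set d | inner x d <= 1].
  by apply/seteqP; split=> d h x Cx; exact: h.
apply: closed_bigI => x Cx.
apply: (@preimage_closed _ _ (inner x) [set t | t <= 1]); last exact: closed_le.
by move=> ? _; exact: inner_continuous.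
Qed.

(** Let [c] be the point of [C] nearest to [z] in the Euclidean sense. By its variational
    inequality, [c] maximizes the functional [z - c] over [C], while [z] exceeds this maximum. *)
Lemma body_separation z : ~ C z -> exists d, supp_fn C d < inner z d.
Proof.
move=> nCz; have [cC _ _ _] := hC.
have [||c /[!inE] Cc cmin] := EVT_min_rV _ cC _ (f := fun v => inner (z - v) (z - v)).
- by exists 0; exact: body0.
- have cz : continuous (fun v : 'rV[R]_m => z - v).
    move=> v; apply: (@continuousB R 'rV[R]_m 'rV[R]_m (cst z) id v).
      exact: cst_continuous.
    exact: cvg_id.
  exact/continuous_subspaceT/continuous_inner.
exists (z - c).
have zc0 : z - c != 0 by apply/eqP => /subr0_eq zc; apply: nCz; rewrite zc.
suff le0 v : C v -> inner (v - c) (z - c) <= 0.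
  have [v Cv <-] := supp_fnP (z - c).
  have := le0 v Cv; have := inner_gt0 (z - c); rewrite zc0 !(innerBl (z - c)) => ? ?; lra.
move=> Cv; rewrite leNgt; apply/negP => a0.
set a := inner (v - c) (z - c) in a0; pose b := inner (v - c) (v - c).
have b0 : 0 < b.
  by rewrite inner_gt0; apply: contraTneq a0 => e; rewrite /a e inner0l ltxx.
(* Moving from [c] towards [v] by [t] changes the squared distance to [z] by [t^2 * b - 2 * t * a],
   which is negative because [t * b <= a]; this contradicts minimality. *)
pose t := Num.min 1 (a / b).
have t0 : 0 < t by rewrite lt_min ltr01 divr_gt0.
have t1 : t <= 1 by rewrite ge_min lexx.
have tb : t * b <= a by rewrite -ler_pdivlMr// ge_min lexx orbT.
have Cw : C (t *: v + (1 - t) *: c) by apply: body_convex => //; rewrite t1 ltW.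
have := cmin (t *: v + (1 - t) *: c); rewrite inE => /(_ Cw).
have -> : z - (t *: v + (1 - t) *: c) = (z - c) - t *: (v - c).
  by apply/rowP => i; rewrite !mxE; ring.
move: t0 tb a0 b0; rewrite /a /b; clearbody t; move: (z - c) (v - c) => w h t0 tb a0 b0.
rewrite innerBl !innerBr !innerZl !innerZr (innerC w h); nra.
Qed.

(* Bipolar theorem: the gauge is the support function of the polar. *)
Lemma gauge_dual z : exists2 u, supp_fn C u <= 1 & inner z u = gauge C z.
Proof.
have [||u /[!inE] Cu umax] := EVT_max_rV _ polar_compact _ (f := inner z).
- by exists 0; rewrite polarE /= supp_fn0.
- exact/continuous_subspaceT/inner_continuous.
have u1 : supp_fn C u <= 1 by move: Cu; rewrite polarE.
exists u => //; apply/le_anti/andP; split.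
  by apply: le_trans (inner_le z u) _; rewrite ler_piMr// gauge_ge0.
have iz0 : 0 <= inner z u by rewrite -(inner0r z) umax// inE polarE /= supp_fn0.
rewrite leNgt; apply/negP => lt; set g := gauge C z in lt.
(* As [k] is below the gauge of [z], the point [k^-1 *: z] is outside [C]. A functional separating
   it, once normalized, would exceed the maximum [inner z u], since [k] is above it. *)
pose k := (inner z u + g) / 2; have k0 : 0 < k by rewrite /k; lra.
have [d] : exists d, supp_fn C d < inner (k^-1 *: z) d.
  apply: body_separation => /gauge_le1; rewrite gaugeZ normfV gtr0_norm//.
  by rewrite ler_pdivrMl// mulr1 -/g /k; lra.
rewrite innerZl ltr_pdivlMl// => dz.
have s0 : 0 < supp_fn C d.
  apply: supp_fn_gt0; apply: contraTneq dz => ->.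
  by rewrite supp_fn0 inner0r mulr0 ltxx.
have := umax ((supp_fn C d)^-1 *: d); rewrite inE polarE /= supp_fnZ normfV gtr0_norm//.
rewrite mulVf ?gt_eqF// innerZr ler_pdivrMl// => /(_ (lexx _)).
by move: dz; rewrite /k; nra.
Qed.

(** The nonzero vector [x] ensures that the dual sphere is nonempty, which matters when [z = 0]. *)
Lemma gauge_dual_unit x z : x != 0 ->
  exists2 u, supp_fn C u = 1 & inner z u = gauge C z.
Proof.
have unit y : y != 0 -> exists2 u, supp_fn C u = 1 & inner y u = gauge C y.
  move=> y0; have [u u1 yu] := gauge_dual y; exists u => //.
  apply/le_anti; rewrite u1 /=; have := inner_le y u.
  by rewrite yu -{1}[gauge C y]mulr1 ler_pM2l// gauge_gt0.
move=> x0; have [->|/unit//] := eqVneq z 0.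
by have [u u1 _] := unit x x0; exists u; rewrite // inner0l gauge0.
Qed.

(** * Boundary points and normal vectors *)

Lemma boundary_gauge y : boundary C y -> gauge C y = 1.
Proof.
rewrite /boundary -(closure_id C).1; last exact: body_closed.
move=> [/gauge_le1 y1 nI]; apply/le_anti; rewrite y1 /= leNgt; apply/negP => lt.
apply: nI; have [K K0 gK] := gauge_norm.
apply/nbhs_ballP; exists ((1 - gauge C y) / K); first by rewrite /= divr_gt0// subr_gt0.
move=> z; rewrite -ball_normE /= distrC ltr_pdivlMr// mulrC => zy.
apply/gauge_le1; rewrite -(subrK y z); apply: le_trans (gaugeD _ _) _.
by have := gK (z - y); lra.
Qed.

(** At an interior point, a slight dilation of [y] would stay in [C] and increase the positive value
    [inner y d]. *)
Lemma maximizer_boundary y d : d != 0 -> C y -> inner y d = supp_fn C d ->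
  boundary C y.
Proof.
move=> d0 Cy yd; split; first exact: subset_closure.
move=> /nbhs_ballP[e /= e0 eC].
pose t := e / (2 * (`|y| + 1)).
have yp : 0 < `|y| + 1 by rewrite ltr_wpDl.
have t0 : 0 < t by rewrite divr_gt0// mulr_gt0.
have : C (y + t *: y).
  apply: eC; rewrite -ball_normE /= opprD addNKr normrN normrZ (gtr0_norm t0).
  rewrite /t mulrAC ltr_pdivrMr ?mulr_gt0//.
  by have := normr_ge0 y; nra.
move=> /(supp_fn_ge d); rewrite innerDl innerZl yd.
by have := mulr_gt0 t0 (supp_fn_gt0 d d0); lra.
Qed.

Lemma normal_coneP y d : C y -> normal_cone C y d <-> inner y d = supp_fn C d.
Proof.
move=> Cy; split=> [dN|yd x Cx].
  apply/le_anti; rewrite supp_fn_ge//=; have [v Cv <-] := supp_fnP d.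
  by have := dN v Cv; rewrite innerC innerBl subr_le0.
by rewrite innerC innerBl yd subr_le0 supp_fn_ge.
Qed.

End Body.

(** * Gradients *)

Section Gradients.
Context {R : realType} {m : nat} {C : set 'rV[R]_m} (hC : sym_convex_body C).
Implicit Types (x y z v d u h : 'rV[R]_m) (f : 'rV[R]_m -> R) (l K q : R).
Local Notation S := (supp_fn C).

(** Since [S] is dominated by the ambient norm and [q > 1], the remainder is of smaller order than
    [h]. *)
Lemma grad_holder f d x K q : 1 < q -> 0 <= K ->
  (forall h, `|f (d + h) - f d - inner x h| <= K * S h `^ q) ->
  differentiable f d /\ grad f d = x.
Proof.
move=> q1 K0 fK; have [M M0 SM] := supp_fn_norm hC.
have q10 : 0 < q - 1 by rewrite subr_gt0.
have fo e : 0 < e -> \forall h \near (0 : 'rV[R]_m), `|f (h + d) - (f d + inner x h)| <= e * `|h|.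
  move=> e0; pose K' := K * M `^ q + 1; have K'0 : 0 < K'.
    by rewrite ltr_wpDl// mulr_ge0// powR_ge0.
  have eK : 0 < e / K' by rewrite divr_gt0.
  (* Within this radius [K' * |h|^(q-1) <= e]. *)
  apply/nbhs_ballP; exists ((e / K') `^ (q - 1)^-1); first exact: powR_gt0.
  move=> h; rewrite -ball_normE /= sub0r normrN => he.
  rewrite [h + d]addrC opprD addrA; apply: le_trans (fK h) _.
  apply: le_trans (_ : K' * `|h| `^ q <= _).
    apply: le_trans (_ : K * (M * `|h|) `^ q <= _).
      by rewrite ler_wpM2l// powR_le ?supp_fn_ge0// ltW// (lt_trans _ q1).
    rewrite powRM ?(ltW M0)// mulrA ler_wpM2r ?powR_ge0// /K'.
    by rewrite lerDl.
  rewrite -(mulr_powRB1 (normr_ge0 h) (lt_trans ltr01 q1)) mulrCA mulrC.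
  rewrite ler_wpM2r// -ler_pdivlMl// mulrC.
  apply: le_trans (_ : ((e / K') `^ (q - 1)^-1) `^ (q - 1) <= _).
    by apply: powR_le; rewrite ?(ltW q10)// ltW.
  by rewrite -powRrM mulVf ?gt_eqF// powRr1// ltW.
have dE : 'd f d = inner x :> ('rV[R]_m -> R).
  have := @diff_unique R 'rV[R]_m R f (inner x) d; apply; first exact: inner_continuous.
  by apply/eqaddoP.
split; last by apply/rowP => i; rewrite mxE dE inner_delta.
by apply/diff_locallyP; rewrite dE; split; [exact: inner_continuous|exact/eqaddoP].
Qed.

(** The linear map [inner v] lies below [S] and touches it at [d], so it is dominated by the
    differential; opposite directions then force equality. *)
Lemma grad_supp_fn d v : differentiable S d -> C v -> inner v d = S d ->
  grad S d = v.
Proof.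
move=> dS Cv vd; suff le h : inner v h <= 'd S d h.
  apply/rowP => i; rewrite mxE -inner_delta; apply/le_anti; rewrite le andbT.
  by have := le (- delta_mx 0 i); rewrite innerNr linearN lerN2.
have small e : 0 < e -> inner v h <= 'd S d h + e * `|h|.
  move=> e0; have /eqaddoP/(_ e e0) := diff_locally dS.
  move=> /nbhs_ballP[r /= r0 rS].
  pose t := r / (2 * (`|h| + 1)).
  have hp : 0 < `|h| + 1 by rewrite ltr_wpDl.
  have t0 : 0 < t by rewrite divr_gt0// mulr_gt0.
  have /rS : ball 0 r (t *: h).
    rewrite -ball_normE /= sub0r normrN normrZ (gtr0_norm t0).
    rewrite /t mulrAC ltr_pdivrMr ?mulr_gt0//.
    by have := normr_ge0 h; nra.
  rewrite [X in `|X|](_ : _ = S (d + t *: h) - (S d + 'd S d (t *: h))); last first.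
    by rewrite [d + _]addrC.
  have lin : 'd S d (t *: h) = t * 'd S d h by rewrite linearZ.
  move=> /ler_normlP[_]; rewrite lin normrZ (gtr0_norm t0) => up.
  have := supp_fn_ge hC (d + t *: h) v Cv; rewrite innerDr innerZr vd => lo.
  rewrite -(ler_pM2l t0); nra.
have [->|h0] := eqVneq h 0; first by rewrite inner0r linear0.
have nh : 0 < `|h| by rewrite normr_gt0.
apply/ler_addgt0Pr => e e0; have := small (e / `|h|); rewrite divfK ?gt_eqF//.
by apply; rewrite divr_gt0.
Qed.

End Gradients.

(** * The implications *)

Section Equivalences.
Context {R : realType} {m : nat} {C : set 'rV[R]_m} (hC : sym_convex_body C).
Implicit Types (x y z v d u h : 'rV[R]_m) (l alpha c : R).
Local Notation N := (gauge C).
Local Notation S := (supp_fn C).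

(** * The assertions as predicates, and the passage from mid-convexity to scaling *)

Definition mid_convex (C : set 'rV[R]_m) p := exists alpha, 0 < alpha /\
  forall x y z, C x -> C y -> gauge C z <= 1 ->
    C ((1/2 : R) *: (x + y) + (alpha * gauge C (x - y) `^ p) *: z).

Definition scaling_inequality (C : set 'rV[R]_m) p := exists alpha, 0 < alpha /\
  forall x y d, C x -> boundary C y -> normal_cone C y d ->
    alpha * gauge (polar C) d * gauge C (y - x) `^ p <= inner d (y - x).

Definition modulus_power_type (C : set 'rV[R]_m) p := exists alpha, 0 < alpha /\
  forall e : R, 0 <= e <= 2 -> ((alpha * e `^ p)%:E <= modulus_convexity C e)%E.

Definition holder_smooth (C : set 'rV[R]_m) q := exists c : R, 0 < c /\
  (forall d, gauge (polar C) d = 1 -> differentiable (supp_fn C) d) /\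
  (forall d1 d2, gauge (polar C) d1 = 1 -> gauge (polar C) d2 = 1 ->
     gauge C (grad (supp_fn C) d1 - grad (supp_fn C) d2)
       <= c * gauge (polar C) (d1 - d2) `^ (q - 1)).

(** Only the inequality of assertion (e), with its constant exposed; differentiability is deduced
    from it separately. *)
Definition uniformly_smooth (C : set 'rV[R]_m) q c :=
  forall d d' l, 0 <= l <= 1 ->
    l * supp_fn C d `^ q + (1 - l) * supp_fn C d' `^ q <=
    supp_fn C (l *: d + (1 - l) *: d') `^ q
      + c / q * l * (1 - l) * gauge (polar C) (d - d') `^ q.

Definition uniformly_convex (C : set 'rV[R]_m) p := exists alpha, 0 < alpha /\
  forall x y l, 0 <= l <= 1 ->
    gauge C (l *: x + (1 - l) *: y) `^ p
      + alpha / p * l * (1 - l) * gauge C (x - y) `^ p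
    <= l * gauge C x `^ p + (1 - l) * gauge C y `^ p.

(** The enlarged midpoint is tested against [d], with [z] a maximizer of [d] over [C]: its value
    cannot exceed [S d = inner y d]. *)
Lemma mid_convex_scaling p : mid_convex C p -> scaling_inequality C p.
Proof.
move=> [a [a0 mid]]; exists (2 * a); split; first by rewrite mulr_gt0.
move=> x y d Cx By Ny.
have Cy : C y by apply/(gauge_le1 hC); rewrite boundary_gauge.
move: Ny => /(normal_coneP hC _ _ Cy) yd; have [z Cz zd] := supp_fnP hC d.
have /(supp_fn_ge hC d) := mid x y z Cx Cy ((gauge_le1 hC z).2 Cz).
rewrite innerDl !innerZl innerDl zd yd gauge_polar// (gaugeBC hC y) (innerC d) innerBl yd.
by move: (N _ `^ p) => n; lra.
Qed.

Context {p q : R} (p1 : 1 < p) (q1 : 1 < q) (pq : p^-1 + q^-1 = 1).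

Let p0 : 0 < p. Proof. exact: lt_trans p1. Qed.
Let q0 : 0 < q. Proof. exact: lt_trans q1. Qed.
Let qp : q^-1 + p^-1 = 1. Proof. by rewrite addrC. Qed.

(** * From the modulus of convexity to scaling *)

Lemma modulus_convexityP alpha :
  (forall e, 0 <= e <= 2 -> ((alpha * e `^ p)%:E <= modulus_convexity C e)%E) ->
  forall x y, N x = 1 -> N y = 1 ->
    alpha * N (x - y) `^ p <= 1 - N ((1/2 : R) *: (x + y)).
Proof.
move=> h x y x1 y1; rewrite -lee_fin.
have n2 : 0 <= N (x - y) <= 2.
  rewrite gauge_ge0//=; apply: le_trans (gaugeD hC _ _) _.
  by rewrite gaugeN// x1 y1.
by apply: le_trans (h _ n2) _; apply: ereal_inf_lbound; exists x, y.
Qed.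

(* A point of the body is a convex combination of two antipodal points of the
   sphere, and the inequality passes to such combinations because [t `^ p] is
   convex. *)
Lemma modulus_scaling : modulus_power_type C p -> scaling_inequality C p.
Proof.
move=> [a [a0 /modulus_convexityP mod]]; exists (2 * a); split; first by rewrite mulr_gt0.
move=> x y d Cx By Ny; have y1 := boundary_gauge hC _ By.
have Cy : C y by apply/(gauge_le1 hC); rewrite y1.
move: Ny => /(normal_coneP hC _ _ Cy) yd; rewrite gauge_polar//.
have S0 := supp_fn_ge0 hC d.
(* For [u] on the sphere, the midpoint of [y] and [u] has value at most its gauge times [S d], and
   the modulus bounds that gauge. *)
have unit u : N u = 1 -> 2 * a * S d * N (y - u) `^ p <= inner (y - u) d.
  move=> u1; have := ler_wpM2r S0 (mod y u y1 u1).
  have := inner_le hC ((1/2 : R) *: (y + u)) d; rewrite innerZl innerDl innerBl yd.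
  move: (N (_ *: _)) (N _ `^ p) => w n; nra.
have [u u1 xu] : exists2 u, N u = 1 & x = N x *: u.
  have [->|x0] := eqVneq x 0; first by exists y => //; rewrite gauge0// scale0r.
  have g0 : N x != 0 by rewrite gt_eqF// gauge_gt0.
  exists ((N x)^-1 *: x); last by rewrite scalerA divff// scale1r.
  by rewrite gaugeZ// normfV ger0_norm ?gauge_ge0// mulVf.
have Nx1 : N x <= 1 by apply/gauge_le1.
have Nx0 := gauge_ge0 hC x.
(* Chosen so that [2 * l - 1 = N x], which makes [x] the combination of [u] and [- u] with weights
   [l] and [1 - l]. *)
pose l := (1 + N x) / 2; have l01 : 0 <= l <= 1 by rewrite /l; lra.
have yx : y - x = l *: (y - u) + (1 - l) *: (y - - u).
  by rewrite {1}xu /l; apply/rowP => i; rewrite !mxE; field.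
have [l0 l1] := andP l01.
have cvx : N (y - x) `^ p <= l * N (y - u) `^ p + (1 - l) * N (y - - u) `^ p.
  apply: le_trans (powR_convex p1 q1 pq l _ _ l01 (gauge_ge0 hC _) (gauge_ge0 hC _)).
  apply: powR_le; rewrite ?(ltW p0) ?gauge_ge0// yx; apply: le_trans (gaugeD hC _ _) _.
  by rewrite !gaugeZ// !ger0_norm ?subr_ge0.
rewrite innerC yx innerDl !innerZl -yx.
have aS : 0 <= 2 * a * S d by rewrite !mulr_ge0// ltW.
apply: (le_trans (ler_wpM2l aS cvx)).
have dist k A B : k * (l * A + (1 - l) * B) = l * (k * A) + (1 - l) * (k * B) by ring.
rewrite dist.
by apply: lerD; apply: ler_wpM2l; rewrite ?subr_ge0//; apply: unit; rewrite ?gaugeN.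
Qed.

(** This form speaks of maximizers only: for nonzero [d] they are boundary points with [d] normal,
    and for [d = 0] both sides vanish. *)
Lemma scaling_maximizer alpha :
  (forall x y d, C x -> boundary C y -> normal_cone C y d ->
    alpha * gauge (polar C) d * gauge C (y - x) `^ p <= inner d (y - x)) ->
  forall x y d, C x -> C y -> inner y d = S d ->
    alpha * S d * N (y - x) `^ p <= inner (y - x) d.
Proof.
move=> sc x y d Cx Cy yd; have [->|d0] := eqVneq d 0.
  by rewrite supp_fn0// inner0r mulr0 mul0r.
rewrite -gauge_polar// innerC; apply: sc => //; last exact/normal_coneP.
exact: maximizer_boundary yd.
Qed.

(** * Smoothness of the support function from the scaling inequality *)

Section Scaling.
Context (alpha : R) (a0 : 0 < alpha).
Context (sc : forall x y d, C x -> C y -> inner y d = S d ->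
    alpha * S d * N (y - x) `^ p <= inner (y - x) d).

(** Optimality of [x2] for [d2] allows [d1] to be replaced by [d1 - d2] in the right side of the
    scaling inequality at [d1]; duality and cancellation of one factor [N (x1 - x2)] finish. *)
Lemma maximizer_dist x1 x2 d1 d2 : C x1 -> C x2 ->
  inner x1 d1 = S d1 -> inner x2 d2 = S d2 -> 0 < S d1 ->
  N (x1 - x2) <= (S (d1 - d2) / (alpha * S d1)) `^ (q - 1).
Proof.
move=> C1 C2 e1 e2 S1.
apply: (le_powR_conj p1 q1 pq); rewrite ?mulr_gt0 ?gauge_ge0 ?supp_fn_ge0//.
apply: le_trans (sc _ _ _ C2 C1 e1) _; rewrite mulrC.
apply: le_trans (inner_le hC _ _); rewrite innerBr lerDl oppr_ge0 innerBl e2.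
by rewrite subr_le0 supp_fn_ge.
Qed.

Lemma supp_fn_holder_smooth : holder_smooth C q.
Proof.
(* With [y] a maximizer at [d + h], the first-order remainder lies between 0 and [inner (y - x) h],
   which [maximizer_dist] bounds by a multiple of [S h^q]. *)
have sphere d : S d = 1 -> forall x, C x -> inner x d = S d ->
    differentiable S d /\ grad S d = x.
  move=> d1 x Cx xd; apply: (grad_holder hC _ _ _ (alpha^-1 `^ (q - 1)) q q1) => [|h].
    exact: powR_ge0.
  have [y Cy yd] := supp_fnP hC (d + h).
  have lo : 0 <= S (d + h) - S d - inner x h.
    by rewrite -xd -addrA -opprD -innerDr subr_ge0 supp_fn_ge.
  rewrite ger0_norm//.
  apply: le_trans (_ : inner (y - x) h <= _).
    rewrite -yd innerDr innerBl; have := supp_fn_ge hC d y Cy; lra.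
  apply: le_trans (inner_le hC _ _) _.
  rewrite -(mulr_powRB1 (supp_fn_ge0 hC h) q0) mulrCA mulrC ler_wpM2l ?supp_fn_ge0//.
  rewrite -powRM ?invr_ge0 ?supp_fn_ge0 ?(ltW a0)// gaugeBC//.
  have := maximizer_dist _ _ _ _ Cx Cy xd yd; rewrite d1 mulr1 => /(_ ltr01).
  by rewrite opprD addNKr supp_fnN// [_ / _]mulrC.
exists (alpha^-1 `^ (q - 1)); split; first by rewrite powR_gt0 ?invr_gt0.
split=> [d|d1 d2]; rewrite !gauge_polar//.
  by move=> d1; have [x Cx xd] := supp_fnP hC d; have [] := sphere d d1 x Cx xd.
move=> h1 h2; have [x1 C1 e1] := supp_fnP hC d1; have [x2 C2 e2] := supp_fnP hC d2.
have [_ ->] := sphere d1 h1 x1 C1 e1; have [_ ->] := sphere d2 h2 x2 C2 e2.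
rewrite -powRM ?invr_ge0 ?supp_fn_ge0 ?(ltW a0)//.
have := maximizer_dist _ _ _ _ C1 C2 e1 e2; rewrite h1 mulr1 => /(_ ltr01).
by rewrite [_ / _]mulrC.
Qed.

(** In the splitting [s1 *: (x1 - x2) + (s1 - s2) *: x2], the factor [s1] cancels the power of
    [S d1] in [maximizer_dist], and [q - 1 <= 1] makes the power itself Hoelder. *)
Lemma scaled_maximizer_holder x1 x2 d1 d2 : q <= 2 -> C x1 -> C x2 ->
  inner x1 d1 = S d1 -> inner x2 d2 = S d2 ->
  N (S d1 `^ (q - 1) *: x1 - S d2 `^ (q - 1) *: x2)
    <= (alpha^-1 `^ (q - 1) + 1) * S (d1 - d2) `^ (q - 1).
Proof.
move=> q2 C1 C2 e1 e2; set s1 := S d1 `^ _; set s2 := S d2 `^ _.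
have -> : s1 *: x1 - s2 *: x2 = s1 *: (x1 - x2) + (s1 - s2) *: x2.
  by apply/rowP => i; rewrite !mxE; ring.
apply: le_trans (gaugeD hC _ _) _; rewrite !gaugeZ// mulrDl mul1r.
have S1 := supp_fn_ge0 hC d1; have S2 := supp_fn_ge0 hC d2.
apply: lerD.
  rewrite ger0_norm ?powR_ge0// /s1; have [->|Sn0] := eqVneq (S d1) 0.
    by rewrite powR0 ?mul0r ?mulr_ge0 ?powR_ge0// gt_eqF// subr_gt0.
  have Sp : 0 < S d1 by rewrite lt_neqAle eq_sym Sn0.
  have dist := maximizer_dist _ _ _ _ C1 C2 e1 e2 Sp.
  apply: le_trans (ler_wpM2l (powR_ge0 _ _) dist) _.
  rewrite -!powRM ?divr_ge0 ?invr_ge0 ?mulr_ge0 ?supp_fn_ge0 ?(ltW a0)//.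
  by rewrite (_ : _ * _ = alpha^-1 * S (d1 - d2))//; field; rewrite Sn0 gt_eqF.
apply: le_trans (_ : `|s1 - s2| * 1 <= _); first by rewrite ler_wpM2l// gauge_le1.
rewrite mulr1; apply: le_trans (powR_dist _ _ _ _ _ S1 S2) _; rewrite ?subr_gt0//; first lra.
apply: powR_le; rewrite ?subr_ge0 ?(ltW q1)//; apply/ler_normlP; split.
  by rewrite opprB lerBlDl supp_fnBC// -{1}(subrKC d1 d2) supp_fnD.
by rewrite lerBlDl -{1}(subrKC d2 d1) supp_fnD.
Qed.

End Scaling.

Lemma scaling_holder_smooth : scaling_inequality C p -> holder_smooth C q.
Proof. by move=> [a [a0 /scaling_maximizer sc]]; exact: supp_fn_holder_smooth sc. Qed.

(** The chain rule for subgradients: the tangent of the [q]-th power at [S d], combined with [x]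
    being a subgradient of [S] at [d]. *)
Lemma supp_fn_pow_subgradient x d d' : C x -> inner x d = S d ->
  S d `^ q + q * S d `^ (q - 1) * inner x (d' - d) <= S d' `^ q.
Proof.
move=> Cx xd.
apply: le_trans (powR_tangent q1 p1 qp _ _ (supp_fn_ge0 hC d') (supp_fn_ge0 hC d)).
rewrite lerD2l ler_wpM2l ?mulr_ge0 ?powR_ge0 ?(ltW q0)//.
by rewrite innerBr xd lerD2r supp_fn_ge.
Qed.

(** The subgradient inequalities at [d] and [d'], evaluated at [d2] and averaged, leave
    [q * l * (1 - l)] times the pairing of [d - d'] with a difference of scaled maximizers. Its
    Hoelder bound [H] gives [c / q = q * H]. *)
Lemma scaling_uniformly_smooth : q <= 2 -> scaling_inequality C p ->
  exists c, 0 < c /\ uniformly_smooth C q c.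
Proof.
move=> q2 [a [a0 /scaling_maximizer sc]].
pose H := a^-1 `^ (q - 1) + 1; have H0 : 0 < H by rewrite ltr_wpDl// powR_ge0.
exists (q * q * H); split; first by rewrite !mulr_gt0.
move=> d d' l /andP[l0 l1]; rewrite gauge_polar//; set d2 := l *: d + _.
have [x Cx xd] := supp_fnP hC d; have [y Cy yd] := supp_fnP hC d'.
have := supp_fn_pow_subgradient _ _ d2 Cx xd; have := supp_fn_pow_subgradient _ _ d2 Cy yd.
have -> : d2 - d = (l - 1) *: (d - d') by apply/rowP => i; rewrite !mxE; ring.
have -> : d2 - d' = l *: (d - d') by apply/rowP => i; rewrite !mxE; ring.
rewrite !innerZr => ybd xbd.
have := inner_le hC (S d `^ (q - 1) *: x - S d' `^ (q - 1) *: y) (d - d').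
have := ler_wpM2r (supp_fn_ge0 hC (d - d')) (scaled_maximizer_holder _ a0 sc _ _ _ _ q2 Cx Cy xd yd).
rewrite -/H mulrAC -mulrA mulr_powRB1 ?supp_fn_ge0// => hb hi.
have {hb hi} := le_trans hi hb; rewrite innerBl !innerZl.
have -> : q * q * H / q = q * H by field; rewrite gt_eqF.
move=> hb; pose G := q * (l * (1 - l)).
have l1' : 0 <= 1 - l by rewrite subr_ge0.
have G0 : 0 <= G by rewrite !mulr_ge0// ltW.
have {hb} := ler_wpM2l G0 hb.
have {xbd} := ler_wpM2l l0 xbd; have {ybd} := ler_wpM2l l1' ybd.
rewrite [leLHS](_ : _ = (1 - l) * S d' `^ q
  + G * (S d' `^ (q - 1) * inner y (d - d'))); last by rewrite /G; ring.
move=> hy; rewrite [leLHS](_ : _ = l * S d `^ q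
  - G * (S d `^ (q - 1) * inner x (d - d'))); last by rewrite /G; ring.
rewrite [X in _ <= _ + X](_ : _ = G * (H * S (d - d') `^ q)); last by rewrite /G; ring.
rewrite (mulrBr G) => hx hb.
have t2E : S d2 `^ q = l * S d2 `^ q + (1 - l) * S d2 `^ q.
  by rewrite -mulrDl subrKC mul1r.
rewrite [X in _ <= X + _]t2E.
move: hy hx hb; clear; move: (G * _) (G * _) (G * _) (_ * S d' `^ q) (_ * S d `^ q) (l * S d2 `^ q)
  (_ * S d2 `^ q) => *; lra.
Qed.

(** The remainders at [h] and [- h] are nonnegative by the subgradient inequality, and smoothness at
    the midpoint of [d + h] and [d - h] bounds their sum, hence each. *)
Lemma uniformly_smooth_differentiable c : 0 < c -> uniformly_smooth C q c ->
  forall d, differentiable (fun d' => S d' `^ q) d.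
Proof.
move=> c0 us d; have [x Cx xd] := supp_fnP hC d.
have l2 : 0 <= (2^-1 : R) <= 1 by lra.
pose K := c / q / 2 * 2 `^ q.
have K0 : 0 <= K by rewrite !mulr_ge0 ?invr_ge0 ?powR_ge0// ltW.
suff [] : differentiable (fun d' => S d' `^ q) d /\
  grad (fun d' => S d' `^ q) d = (q * S d `^ (q - 1)) *: x by [].
apply: (grad_holder hC _ _ _ K q q1 K0) => h; rewrite innerZl.
have sub e := supp_fn_pow_subgradient x d (d + e) Cx xd.
have := sub h; have := sub (- h).
rewrite addrAC subrr add0r addrAC subrr add0r innerNr => lo hi.
rewrite ger0_norm; last by rewrite -addrA -opprD subr_ge0.
have := us (d + h) (d - h) 2^-1 l2.
have -> : 2^-1 *: (d + h) + (1 - 2^-1) *: (d - h) = d.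
  by apply/rowP => i; rewrite !mxE; field.
have -> : d + h - (d - h) = 2 *: h by apply/rowP => i; rewrite !mxE; ring.
rewrite gauge_polar// supp_fnZ// ger0_norm// powRM ?supp_fn_ge0// => mid.
have KE : c / q / 2 * (2 `^ q * S h `^ q) = K * S h `^ q by rewrite mulrA.
move: mid; rewrite [_ * (1 - 2^-1) * _]mulrAC KE.
move: lo; rewrite mulrN; clear.
move: (K * _) (_ * inner x h) (S (d + h) `^ q) (S (d - h) `^ q) (S d `^ q) => *; lra.
Qed.

(** * From smoothness of the support function to convexity of the gauge *)

Lemma inner_young x d : inner x d <= N x `^ p / p + S d `^ q / q.
Proof.
apply: le_trans (inner_le hC x d) _.
by apply: (powR_young p1 q1 pq); rewrite ?gauge_ge0 ?supp_fn_ge0.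
Qed.

(** A norming functional of [z] scaled by [k * N z^(p-1)]; for [k = 1] this is the equality case of
    Young's inequality. *)
Lemma inner_young_eq k z : 0 <= k ->
  exists2 d, inner z d = k * N z `^ p & S d `^ q <= k `^ q * N z `^ p.
Proof.
move=> k0; have [u u1 zu] := gauge_dual hC z; have z0 := gauge_ge0 hC z.
exists ((k * N z `^ (p - 1)) *: u).
  by rewrite innerZr zu -mulrA [_ * N z]mulrC mulr_powRB1.
rewrite -(conj_powR p1 q1 pq) -powRM ?powR_ge0// supp_fnZ//.
have kz : 0 <= k * N z `^ (p - 1) by rewrite mulr_ge0// powR_ge0.
apply: powR_le; rewrite ?(ltW q0) ?mulr_ge0 ?supp_fn_ge0// ger0_norm//.
by rewrite ler_piMr.
Qed.

(** Scalar bookkeeping: the averaged Young inequalities gain [l * (1 - l) * k * n], and the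
    smoothness inequality divided by [q] costs half of that. *)
Lemma young_combination (l k n nz nx ny s s' xd yd xw yw : R) :
  l * xd + (1 - l) * yd = nz -> xw - yw = k * n ->
  l * (xd + (1 - l) * xw) <= l * (nx / p + s / q) ->
  (1 - l) * (yd - l * yw) <= (1 - l) * (ny / p + s' / q) ->
  l * s + (1 - l) * s' <= nz + q * (l * (1 - l)) * (k / 2 * n) ->
  nz + p * (k / 2) * l * (1 - l) * n <= l * nx + (1 - l) * ny.
Proof.
move=> zE xyE hx hy hs.
have iq0 : 0 < q^-1 by rewrite invr_gt0.
have sum := lerD hx hy; have {hs} := hs; rewrite -(ler_pM2l iq0) => hs.
have e1 : l * (xd + (1 - l) * xw) + (1 - l) * (yd - l * yw)
    = nz + l * (1 - l) * (k * n) by rewrite -zE -xyE; ring.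
have e2 : l * (nx / p + s / q) + (1 - l) * (ny / p + s' / q)
    = p^-1 * (l * nx + (1 - l) * ny) + q^-1 * (l * s + (1 - l) * s') by ring.
have e3 : q^-1 * (nz + q * (l * (1 - l)) * (k / 2 * n))
    = nz - p^-1 * nz + l * (1 - l) * (k * n) / 2.
  have -> : p^-1 = 1 - q^-1 by rewrite -pq addrK.
  by field; rewrite gt_eqF.
rewrite -(ler_pM2l (_ : 0 < p^-1)) ?invr_gt0//.
have -> : p^-1 * (nz + p * (k / 2) * l * (1 - l) * n)
    = p^-1 * nz + l * (1 - l) * (k * n) / 2 by field; rewrite gt_eqF.
move: sum hs; rewrite e1 e2 e3.
move: (p^-1 * _) (p^-1 * _) (q^-1 * _) (l * _ * _) => *; lra.
Qed.

(* Young's inequality at x and y is taken at the dual points d2 + (1 - l) w and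
   d2 - l w, whose convex combination is d2: here d2 is the equality case at
   l x + (1 - l) y, and w, aligned with x - y, produces the gain. *)
Lemma uniformly_smooth_convex c : 0 < c -> uniformly_smooth C q c ->
  uniformly_convex C p.
Proof.
move=> c0 us.
have A0 : 0 <= c / q / q by rewrite !mulr_ge0 ?invr_ge0// ltW.
(* Makes the smoothness loss [c / q / q * k^q] at most half of the gain [k]. *)
have [k [k0 _ kA]] := small_multiplier p1 q1 pq _ 1 A0 ltr01.
exists (p * p * k / 2); split; first by rewrite !mulr_gt0// invr_gt0.
move=> x y l l01; have [l0 l1] := andP l01; set z := l *: x + _.
have [d2 zd2 Sd2] := inner_young_eq 1 z ler01.
have [w xyw Sw] := inner_young_eq k (x - y) (ltW k0).
have := us (d2 + (1 - l) *: w) (d2 - l *: w) l l01.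
have -> : l *: (d2 + (1 - l) *: w) + (1 - l) *: (d2 - l *: w) = d2.
  by apply/rowP => i; rewrite !mxE; ring.
have -> : d2 + (1 - l) *: w - (d2 - l *: w) = w.
  by apply/rowP => i; rewrite !mxE; ring.
rewrite gauge_polar// => usw.
have yx := inner_young x (d2 + (1 - l) *: w).
have yy := inner_young y (d2 - l *: w).
move: zd2; rewrite {1}/z innerDl !innerZl mul1r => zd2.
move: xyw Sd2 yx yy; rewrite innerBl powR1 mul1r innerDr innerBr !innerZr => xyw Sd2 yx yy.
have ll : 0 <= l * (1 - l) by rewrite mulr_ge0// subr_ge0.
have l1' : 0 <= 1 - l by rewrite subr_ge0.
have -> : p * p * k / 2 / p = p * (k / 2) by field; rewrite gt_eqF.
have hx := ler_wpM2l l0 yx; have hy := ler_wpM2l l1' yy.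
have n0 : 0 <= N (x - y) `^ p by exact: powR_ge0.
have hw : c / q * l * (1 - l) * S w `^ q <= q * (l * (1 - l)) * (k / 2 * N (x - y) `^ p).
  apply: le_trans (_ : c / q * l * (1 - l) * (k `^ q * N (x - y) `^ p) <= _).
    by rewrite ler_wpM2l// !mulr_ge0 ?invr_ge0 ?subr_ge0// ltW.
  have := ler_wpM2l (mulr_ge0 (mulr_ge0 (ltW q0) ll) n0) kA.
  rewrite (_ : q * _ * _ * (c / q / q * _) = c / q * l * (1 - l) * (k `^ q * N (x - y) `^ p)).
    by move=> /le_trans; apply; rewrite le_eqVlt; apply/orP; left; apply/eqP; ring.
  by field; rewrite gt_eqF.
move: zd2 xyw hx hy (le_trans usw (lerD Sd2 hw)).
move: (N (x - y) `^ p) (N z `^ p) (N x `^ p) (N y `^ p) (S _ `^ q) (S _ `^ q)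
  (inner x d2) (inner y d2) (inner x w) (inner y w)
  => n nz nx ny s s' xd yd xw yw zd2 xyw hx hy hs.
exact: (young_combination _ _ _ _ _ _ _ _ _ _ _ _ zd2 xyw hx hy hs).
Qed.

(** At [l = 1/2] the [p]-th power of the midpoint gauge is at most 1 minus [a / (4 * p)] times
    [N (x - y)^p]; the tangent at 1 removes the power at the cost of one more factor [p]. *)
Lemma uniformly_convex_mid : uniformly_convex C p -> mid_convex C p.
Proof.
move=> [a [a0 uc]]; exists (a / p / p / 4); split; first by rewrite !divr_gt0.
move=> x y z Cx Cy z1; apply/(gauge_le1 hC).
apply: le_trans (gaugeD hC _ _) _.
have n0 := powR_ge0 (N (x - y)) p.
have a4 : 0 <= a / p / p / 4 by apply: ltW; rewrite !divr_gt0.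
rewrite (gaugeZ hC (_ * _)) ger0_norm; last exact: mulr_ge0.
apply: le_trans (_ : N ((1 / 2 : R) *: (x + y)) + a / p / p / 4 * N (x - y) `^ p <= _).
  by rewrite lerD2l ler_piMr//; exact: mulr_ge0.
have l2 : 0 <= (1 / 2 : R) <= 1 by lra.
have := uc x y (1 / 2) l2.
have -> : (1 / 2 : R) *: x + (1 - 1 / 2) *: y = (1 / 2 : R) *: (x + y).
  by apply/rowP => i; rewrite !mxE; field.
have ball v : C v -> N v `^ p <= 1.
  move=> /(gauge_le1 hC) v1; have := powR_le p _ 1 (ltW p0) (gauge_ge0 hC v) v1.
  by rewrite powR1.
have := ball x Cx; have := ball y Cy.
have := powR_tangent p1 q1 pq _ _ (gauge_ge0 hC ((1 / 2 : R) *: (x + y))) ler01.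
rewrite !powR1 mulr1; set w := N _; set n := N (x - y) `^ p => tg hy hx h.
rewrite -(ler_pM2l p0) mulrDr.
have -> : p * (a / p / p / 4 * n) = a / p * (1 / 2) * (1 - 1 / 2) * n.
  by field; rewrite gt_eqF.
move: tg hy hx h; move: (a / p * _ * _ * n) (w `^ p) (N x `^ p) (N y `^ p) => *; lra.
Qed.

(** Both [S (d + h)] and [S (d - h)] are at least 1/2, where normalization is Lipschitz; each of the
    two terms of the splitting is at most [4 * S h]. *)
Lemma normalize_dist d h : S d = 1 -> S h <= 2^-1 ->
  S ((S (d + h))^-1 *: (d + h) - (S (d - h))^-1 *: (d - h)) <= 8 * S h.
Proof.
move=> d1 h2; set a := S (d + h); set b := S (d - h).
have uv : S (d + h - (d - h)) <= 2 * S h.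
  have -> : d + h - (d - h) = 2 *: h by apply/rowP => i; rewrite !mxE; ring.
  by rewrite supp_fnZ// ger0_norm.
have a2 : 2^-1 <= a.
  by have := supp_fnD hC (d + h) (- h); rewrite addrK d1 supp_fnN// -/a; lra.
have b2 : 2^-1 <= b by have := supp_fnD hC (d - h) h; rewrite subrK d1 -/b; lra.
have ab : `|b - a| <= 2 * S h.
  apply: le_trans uv; apply/ler_normlP; split.
    by rewrite opprB lerBlDl /a /b -{1}(subrKC (d - h) (d + h)) supp_fnD.
  by rewrite lerBlDl supp_fnBC// /a /b -{1}(subrKC (d + h) (d - h)) supp_fnD.
have a0 : 0 < a by lra. have b0 : 0 < b by lra.
have split_diff (r s : R) (u v : 'rV[R]_m) : r *: u - s *: v = r *: (u - v) + (r - s) *: v.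
  by rewrite scalerBr scalerBl addrA subrK.
rewrite split_diff.
apply: le_trans (supp_fnD hC _ _) _; rewrite !supp_fnZ// -/b.
have -> : a^-1 - b^-1 = (b - a) * (a^-1 * b^-1) by field; rewrite !gt_eqF.
rewrite normrM !(ger0_norm (x := _^-1)) ?(ger0_norm (x := _ * _)) ?mulr_ge0 ?invr_ge0 ?(ltW a0) ?(ltW b0)//.
have -> : `|b - a| * (a^-1 * b^-1) * b = a^-1 * `|b - a| by field; rewrite !gt_eqF.
rewrite -mulrDr ler_pdivrMl//; have := supp_fn_ge0 hC h; nra.
Qed.

Lemma holder_smooth_modulus : holder_smooth C q -> modulus_power_type C p.
Proof.
move=> [c [c0 [dS hS]]].
(* Gradients at unit functionals are the maximizers, so the hypothesis bounds distances between
   maximizers. *)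
have holder d1 d2 x1 x2 : S d1 = 1 -> S d2 = 1 -> C x1 -> C x2 ->
    inner x1 d1 = 1 -> inner x2 d2 = 1 -> N (x1 - x2) <= c * S (d1 - d2) `^ (q - 1).
  move=> h1 h2 C1 C2 e1 e2; have := hS d1 d2; rewrite !gauge_polar// => /(_ h1 h2).
  rewrite (grad_supp_fn hC d1 x1) ?(grad_supp_fn hC d2 x2) ?h1 ?h2//;
    by apply: dS; rewrite gauge_polar.
pose K := c * 8 `^ (q - 1); have K0 : 0 < K by rewrite mulr_gt0// powR_gt0.
(* For maximizers [x], [y] at [d + h], [d - h], the sum is at most [2 + inner (x - y) h]. They also
   maximize the normalized functionals, so [holder] applies. *)
have smooth d h : S d = 1 -> S h <= 2^-1 -> S (d + h) + S (d - h) <= 2 + K * S h `^ q.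
  move=> d1 h2; have [x Cx xu] := supp_fnP hC (d + h); have [y Cy yv] := supp_fnP hC (d - h).
  have h0 := supp_fn_ge0 hC h.
  have a0 : 0 < S (d + h).
    by have := supp_fnD hC (d + h) (- h); rewrite addrK d1 supp_fnN//; lra.
  have b0 : 0 < S (d - h) by have := supp_fnD hC (d - h) h; rewrite subrK d1; lra.
  have unit v : 0 < S v -> S ((S v)^-1 *: v) = 1.
    by move=> v0; rewrite supp_fnZ// normfV gtr0_norm// mulVf// gt_eqF.
  have xy : N (x - y) <= c * (8 * S h) `^ (q - 1).
    apply: le_trans (_ : c * S ((S (d + h))^-1 *: (d + h) - (S (d - h))^-1 *: (d - h)) `^ (q - 1) <= _).
      by apply: holder; rewrite ?innerZr ?xu ?yv ?unit// mulVf// gt_eqF.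
    rewrite ler_wpM2l ?(ltW c0)//; apply: powR_le; rewrite ?supp_fn_ge0 ?subr_ge0 ?(ltW q1)//.
    exact: normalize_dist.
  have := le_trans (inner_le hC (x - y) h) (ler_wpM2r h0 xy).
  rewrite powRM// mulrA -/K -mulrA [_ * S h]mulrC mulr_powRB1// innerBl -xu -yv.
  have := supp_fn_ge hC d x Cx; have := supp_fn_ge hC d y Cy.
  rewrite d1 innerDr innerBr; lra.
(* Since [N (x - y) <= 2], any [k <= k0] keeps the perturbation size [t] below 1/2, as [smooth]
   requires. *)
pose k0 := (2 * 2 `^ (p - 1))^-1 : R.
have k00 : 0 < k0 by rewrite invr_gt0 mulr_gt0// powR_gt0.
have [k [kp kk0 kK]] := small_multiplier p1 q1 pq K k0 (ltW K0) k00.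
exists (k / 4); split; first by rewrite divr_gt0.
move=> e /andP[e0 e2]; apply: le_ereal_inf_tmp => _ [x [y [x1 y1 exy ->]]].
rewrite lee_fin; set z := _ *: (x + y); set n := N (x - y).
have n2 : n <= 2 by apply: le_trans (gaugeD hC _ _) _; rewrite gaugeN// x1 y1.
have n0 : 0 <= n := gauge_ge0 hC _.
have xn0 : x != 0 by apply: contra_eq_neq x1 => ->; rewrite gauge0// eq_sym oner_eq0.
have [d d1 zd] := gauge_dual_unit hC x z xn0.
have [w w1 xyw] := gauge_dual hC (x - y).
pose t := k * n `^ (p - 1).
have t0 : 0 <= t by rewrite mulr_ge0 ?powR_ge0// ltW.
have Sh : S (t *: w) <= t by rewrite supp_fnZ// ger0_norm// ler_piMr.
have t2 : t <= 2^-1.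
  apply: le_trans (_ : k0 * 2 `^ (p - 1) <= _).
    by rewrite ler_pM ?powR_ge0 ?(ltW kp)// powR_le// subr_ge0 ltW.
  by rewrite /k0 invfM -mulrA mulVf ?mulr1// gt_eqF// powR_gt0.
have := smooth d (t *: w) d1 (le_trans Sh t2).
have := inner_le hC x (d + t *: w); have := inner_le hC y (d - t *: w).
rewrite x1 y1 !mul1r innerBr innerDr !innerZr => hy hx hs.
have hq : K * S (t *: w) `^ q <= k / 2 * n `^ p.
  apply: le_trans (_ : K * t `^ q <= _).
    by rewrite ler_wpM2l ?(ltW K0)// powR_le ?supp_fn_ge0// ltW.
  rewrite /t powRM ?powR_ge0 ?(ltW kp)// (conj_powR p1 q1 pq) mulrA.
  by rewrite ler_wpM2r// powR_ge0.
have tn : t * inner x w - t * inner y w = k * n `^ p.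
  by rewrite -mulrBr -innerBl xyw -mulrA [_ * N _]mulrC mulr_powRB1.
have zE : 2 * N z = inner x d + inner y d.
  by rewrite -zd innerZl innerDl; field.
have := ler_wpM2l (ltW kp) (powR_le p e n (ltW p0) e0 exy).
move: (n `^ p) (e `^ p) hq tn => np ep hq tn; lra.
Qed.

End Equivalences.

Theorem mainTheorem1 (R : realType) (m : nat) (p q : R)
  (hp : 2 <= p) (hq1 : 1 < q) (hq2 : q <= 2) (hpq : 1 / p + 1 / q = 1)
  (C : set 'rV[R]_m) (hC : sym_convex_body C) :
  [<->
   (* (a) set mid-convex *)
   (exists alpha : R, 0 < alpha /\
      forall x y z, C x -> C y -> gauge C z <= 1 ->
        C ((1/2 : R) *: (x + y) + (alpha * gauge C (x - y) `^ p) *: z));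
   (* (b) global scaling inequality *)
   (exists alpha : R, 0 < alpha /\
      forall x y d, C x -> boundary C y -> normal_cone C y d ->
        alpha * gauge (polar C) d * gauge C (y - x) `^ p <= inner d (y - x));
   (* (c) modulus of convexity *)
   (exists alpha : R, 0 < alpha /\
      forall e : R, 0 <= e <= 2 ->
        ((alpha * e `^ p)%:E <= modulus_convexity C e)%E);
   (* (d) support function Hoelder-smooth on the dual sphere *)
   (exists c : R, 0 < c /\
      (forall d, gauge (polar C) d = 1 -> differentiable (supp_fn C) d) /\
      (forall d1 d2, gauge (polar C) d1 = 1 -> gauge (polar C) d2 = 1 ->
         gauge C (grad (supp_fn C) d1 - grad (supp_fn C) d2)
           <= c * gauge (polar C) (d1 - d2) `^ (q - 1)));
   (* (e) sigma_C^q uniformly smooth *)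
   ((forall d, differentiable (fun d' => supp_fn C d' `^ q) d) /\
    exists c : R, 0 < c /\
      forall d d' (l : R), 0 <= l <= 1 ->
        l * supp_fn C d `^ q + (1 - l) * supp_fn C d' `^ q <=
        supp_fn C (l *: d + (1 - l) *: d') `^ q
          + c / q * l * (1 - l) * gauge (polar C) (d - d') `^ q);
   (* (f) gauge^p uniformly convex *)
   (exists alpha : R, 0 < alpha /\
      forall x y (l : R), 0 <= l <= 1 ->
        gauge C (l *: x + (1 - l) *: y) `^ p
          + alpha / p * l * (1 - l) * gauge C (x - y) `^ p
        <= l * gauge C x `^ p + (1 - l) * gauge C y `^ p)
  ].
Proof.
have p1 : 1 < p by lra.
have pq : p^-1 + q^-1 = 1 by move: hpq; rewrite !div1r.
have ab := @mid_convex_scaling R m C hC p.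
have bd := scaling_holder_smooth hC p1 hq1 pq.
have dc := holder_smooth_modulus hC p1 hq1 pq.
have cb := modulus_scaling hC p1 hq1 pq.
have be := scaling_uniformly_smooth hC p1 hq1 pq hq2.
have e_diff := uniformly_smooth_differentiable hC p1 hq1 pq.
have ef := uniformly_smooth_convex hC p1 hq1 pq.
have fa := uniformly_convex_mid hC p1 hq1 pq.
(* The cycle follows the order of the list: (b) reaches (c) through (d), (c) reaches (d) through
   (b), and (d) reaches (e) through (c) and (b). *)
tfae.
- exact: ab.
- by move=> b; exact: dc (bd b).
- by move=> c; exact: bd (cb c).
- move=> d; have [c [c0 us]] := be (cb (dc d)).
  by split; [exact: e_diff c0 us|exists c].
- by move=> [_ [c [c0 us]]]; exact: ef c0 us.
- exact: fa.
Qed.
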